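(* Let $K$ be a field of characteristic $0$, let $E=\bigsqcup_{i\ge 1}E_i$ be a non-empty graded set (elements of $E_i$ have degree $i$, each $E_i$ finite), and let $\mathcal L(E)=\bigoplus_{i\ge 1}\mathcal L_i$ be the free Lie algebra over $K$ generated by $E$, graded by the degree of the generators. The operation $\rhd$ on $\mathcal L(E)$ defined for homogeneous $x$ and arbitrary $y$ by $x\rhd y:=\frac{1}{|x|}[x,y]$ (extended linearly in $x$) is a bilinear product which satisfies the (left) pre-Lie identity.
   Context: $|x|$ denotes the degree of a (nonzero) homogeneous element $x\in\mathcal L_{|x|}$; the grading of $\mathcal L(E)$ is the one for which each $a\in E_i$ has degree $i$ and the bracket is additive in degrees. The left pre-Lie identity for a bilinear operation $\rhd$ is $(x\rhd y)\rhd z-x\rhd(y\rhd z)=(y\rhd x)\rhd z-y\rhd(x\rhd z)$ for all $x,y,z$. *)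

(* Defs.v *)
From HB Require Import structures.
From mathcomp Require Import all_boot all_order all_algebra.
From mathcomp Require Import all_classical.

Set Implicit Arguments.
Unset Strict Implicit.
Unset Printing Implicit Defensive.

Import GRing.Theory.
Local Open Scope ring_scope.

Definition bilinear_op (K : pzRingType) (U : lmodType K) (op : U -> U -> U) :=
  (forall y, linear (op^~ y)) /\ (forall x, linear (op x)).

HB.mixin Record Lmodule_isLie (K : comNzRingType) L of GRing.Lmodule K L := {
  lie_bracket : L -> L -> L;
  lie_bilinear : bilinear_op lie_bracket;
  lie_alternating : forall x, lie_bracket x x = 0;
  lie_jacobi : forall x y z,
    lie_bracket x (lie_bracket y z) + lie_bracket y (lie_bracket z x)
      + lie_bracket z (lie_bracket x y) = 0
}.

#[short(type="lieAlgType")]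
HB.structure Definition LieAlgebra (K : comNzRingType) :=
  {L of GRing.Lmodule K L & Lmodule_isLie K L}.

Notation "[lie x , y ]" := (lie_bracket x y)
  (at level 0, format "[lie  x ,  y ]") : ring_scope.

Definition lie_morphism (K : comNzRingType) (L M : lieAlgType K)
    (f : {linear L -> M}) :=
  forall x y, f [lie x, y] = [lie f x, f y].

Definition is_free_lie (K : comNzRingType) (E : Type) (L : lieAlgType K)
    (iota : E -> L) :=
  forall (M : lieAlgType K) (g : E -> M),
    (exists f : {linear L -> M}, lie_morphism f /\ f \o iota =1 g) /\
    (forall f1 f2 : {linear L -> M},
       lie_morphism f1 -> f1 \o iota =1 g ->
       lie_morphism f2 -> f2 \o iota =1 g -> f1 =1 f2).

(* [homogeneous deg iota n x] says that x lies in the component of degree n: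
   these components are the smallest subspaces such that every generator e
   lies in degree [deg e] and the bracket is additive in degrees, i.e. the
   component of degree n is spanned by the iterated brackets of generators
   whose degrees add up to n. As usual, 0 is in every component. *)
Inductive homogeneous (K : comNzRingType) (E : Type) (L : lieAlgType K)
    (deg : E -> nat) (iota : E -> L) : nat -> L -> Prop :=
| homogeneous_gen e : homogeneous deg iota (deg e) (iota e)
| homogeneous_bracket m n x y :
    homogeneous deg iota m x -> homogeneous deg iota n y ->
    homogeneous deg iota (m + n)%N [lie x, y]
| homogeneous0 n : homogeneous deg iota n 0
| homogeneous_linear n a x y :
    homogeneous deg iota n x -> homogeneous deg iota n y ->
    homogeneous deg iota n (a *: x + y).

(* Every element is a sum of homogeneous ones, so that these two conditions
   leave no freedom in the choice of [rhd]. *)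
Definition is_scaled_bracket (K : fieldType) (E : Type) (L : lieAlgType K)
    (deg : E -> nat) (iota : E -> L) (rhd : L -> L -> L) :=
  (forall y, linear (rhd^~ y)) /\
  (forall n x y, homogeneous deg iota n x -> rhd x y = n%:R^-1 *: [lie x, y]).

Definition left_pre_lie (V : zmodType) (rhd : V -> V -> V) :=
  forall x y z, rhd (rhd x y) z - rhd x (rhd y z)
              = rhd (rhd y x) z - rhd y (rhd x z).

(* Main.v *)
Require Import Defs.
From HB Require Import structures.
From mathcomp Require Import all_boot all_order all_algebra.
From mathcomp Require Import all_classical.

Set Implicit Arguments.
Unset Strict Implicit.
Unset Printing Implicit Defensive.

Import GRing.Theory.
Local Open Scope ring_scope.
Local Open Scope classical_set_scope.

(** The product exists and is pre-Lie because it comes from an invertible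
    derivation. Let [d] be the Euler derivation of the free Lie algebra, the
    derivation that multiplies every generator [e] by its degree. By the Leibniz
    rule it multiplies the component of degree [n] by [n] (the lemma
    [homogeneous_degree]). Suppose that [d] has an inverse [T]. Then [T] divides
    the component of degree [n] by [n], so that the scaled bracket is
    [(x, y) |-> [lie T x, y]], and the pre-Lie identity needs no grading any
    more ([derivation_pre_lie]): with [u := T x] and [v := T y], the Leibniz
    rule reads [[lie u, v] = T [lie u, y] - T [lie v, x]], and bracketing it
    with [z] and expanding the left-hand side by the Jacobi identity gives the
    pre-Lie identity.

    The two ingredients come from the universal property.

    - [d] exists ([free_lie_derivation]) because derivations of [L] are the
      sections of the projection of [L * L], with the bracket of the Lie algebra
      [L[eps]] over the dual numbers, onto [L].

    - [L] is spanned by homogeneous elements of positive degree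
      ([free_lie_homogeneous_span]), because their span is a Lie subalgebra that
      contains the generators ([free_lie_gen]).

    On such a spanning set [d] acts by nonzero scalars, as the characteristic is
    zero. It is therefore onto. It is one-to-one because each element is killed
    by a product of maps [d - c] with all [c] nonzero, and such a product acts
    on the kernel of [d] as a nonzero scalar ([shift_prod_ker]). Uniqueness of
    the product is again the spanning property. *)

(** * Elementary rules for the bracket *)

Section LieTheory.
Variables (K : comNzRingType) (L : lieAlgType K).
Implicit Types x y z : L.

Lemma lieDl x y z : [lie x + y, z] = [lie x, z] + [lie y, z].
Proof. by have := (lie_bilinear (s:=L)).1 z 1 x y; rewrite !scale1r. Qed.

Lemma lieDr x y z : [lie z, x + y] = [lie z, x] + [lie z, y].
Proof. by have := (lie_bilinear (s:=L)).2 z 1 x y; rewrite !scale1r. Qed.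

Lemma lie0l z : [lie 0, z] = 0 :> L.
Proof. by apply: (@addrI _ [lie 0, z]); rewrite -lieDl !addr0. Qed.

Lemma lie0r z : [lie z, 0] = 0 :> L.
Proof. by apply: (@addrI _ [lie z, 0]); rewrite -lieDr !addr0. Qed.

Lemma lieZl a x z : [lie a *: x, z] = a *: [lie x, z].
Proof. by have := (lie_bilinear (s:=L)).1 z a x 0; rewrite /= lie0l !addr0. Qed.

Lemma lieZr a x z : [lie z, a *: x] = a *: [lie z, x].
Proof. by have := (lie_bilinear (s:=L)).2 z a x 0; rewrite /= lie0r !addr0. Qed.

Lemma lieC x y : [lie x, y] = - [lie y, x].
Proof.
apply/eqP; rewrite -addr_eq0; apply/eqP.
have := lie_alternating (x + y).
by rewrite lieDl !lieDr !lie_alternating add0r addr0.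
Qed.

Lemma lieNl x z : [lie - x, z] = - [lie x, z].
Proof. by rewrite -!scaleN1r lieZl. Qed.

Lemma lieNr x z : [lie z, - x] = - [lie z, x].
Proof. by rewrite -!scaleN1r lieZr. Qed.

(** The Jacobi identity, as the statement that [x |-> [lie x, _]] turns brackets
    into commutators. *)
Lemma lie_jacobi_ad x y z :
  [lie [lie x, y], z] = [lie x, [lie y, z]] - [lie y, [lie x, z]].
Proof.
have /eqP := lie_jacobi x y z.
by rewrite (lieC z [lie x, y]) subr_eq0 (lieC z x) lieNr => /eqP.
Qed.

End LieTheory.

(** * Subalgebras of a free Lie algebra *)

Section Subalgebra.
Variables (K : comNzRingType) (L : lieAlgType K) (S : {pred L}).
Hypotheses (S_submod : submod_closed S)
  (S_lie : {in S &, forall x y, [lie x, y] \in S}).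

HB.instance Definition _ := GRing.isSubmodClosed.Build K L S S_submod.
Definition subalg := {x : L | x \in S}.
HB.instance Definition _ := SubChoice.on subalg.
HB.instance Definition _ := [SubChoice_isSubLmodule of subalg by <:].
Let bracket (u v : subalg) : subalg :=
  exist (fun y => y \in S) _ (S_lie (valP u) (valP v)).

Fact sub_bilinear : bilinear_op bracket.
Proof.
split=> v a x y; apply: val_inj; rewrite linearP /=.
  by rewrite lieDl lieZl.
by rewrite lieDr lieZr.
Qed.

Fact sub_alternating u : bracket u u = 0.
Proof. exact/val_inj/lie_alternating. Qed.

Fact sub_jacobi u v w :
  bracket u (bracket v w) + bracket v (bracket w u) + bracket w (bracket u v)
  = 0.
Proof. exact/val_inj/lie_jacobi. Qed.

HB.instance Definition _ :=
  Lmodule_isLie.Build K subalg sub_bilinear sub_alternating sub_jacobi.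

(** The universal property gives a morphism to the subalgebra [S]; followed by
    the inclusion it fixes the generators, so it is the identity of [L] and [S]
    is everything. *)
Lemma free_lie_gen (E : Type) (iota : E -> L) : is_free_lie iota ->
  (forall e, iota e \in S) -> forall x, x \in S.
Proof.
move=> freeL S_iota x.
pose g e : subalg := exist (fun y => y \in S) _ (S_iota e).
have [[f [f_lie f_gen]] _] := freeL subalg g.
have [_ unique_id] := freeL L iota.
suff -> : x = \val (f x) by exact: valP.
apply: (unique_id idfun (\val \o f)) => // [u v|e] /=; first by rewrite f_lie.
by have /= -> := f_gen e.
Qed.

End Subalgebra.

(** * Dual numbers and derivations *)

Section DualNumbers.
Variables (K : comNzRingType) (L : lieAlgType K).

(** The pair [(x, p)] stands for [x + eps p] with [eps ^ 2 = 0]. The type is a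
    new name for the product, which keeps this bracket apart from the
    componentwise one. *)
Definition dual_lie := (L * L)%type.
HB.instance Definition _ := GRing.Lmodule.on dual_lie.
Definition dual_bracket (u v : dual_lie) : dual_lie :=
  ([lie u.1, v.1], [lie u.1, v.2] + [lie u.2, v.1]).

Fact dual_bilinear : bilinear_op dual_bracket.
Proof.
split=> -[z c] a [x p] [y q]; congr pair => /=.
- by rewrite lieDl lieZl.
- by rewrite !lieDl !lieZl scalerDr addrACA.
- by rewrite lieDr lieZr.
- by rewrite !lieDr !lieZr scalerDr addrACA.
Qed.

Fact dual_alternating u : dual_bracket u u = 0.
Proof.
by case: u => x p; congr pair; rewrite /= ?lie_alternating // lieC addNr.
Qed.

Fact dual_jacobi u v w :
  dual_bracket u (dual_bracket v w) + dual_bracket v (dual_bracket w u)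
    + dual_bracket w (dual_bracket u v) = 0.
Proof.
case: u v w => [x p] [y q] [z r]; congr pair => /=; first exact: lie_jacobi.
(* The coefficient of eps is the sum of three Jacobi identities, according to
   which of the three arguments contributes its second component. *)
rewrite !lieDr.
transitivity (([lie x, [lie y, r]] + [lie y, [lie r, x]] + [lie r, [lie x, y]])
  + ([lie x, [lie q, z]] + [lie q, [lie z, x]] + [lie z, [lie x, q]])
  + ([lie p, [lie y, z]] + [lie y, [lie z, p]] + [lie z, [lie p, y]])).
  by rewrite [LHS](AC (((2*1)*(2*1))*(2*1))
               (((1*5)*9)*((2*6)*7)*((3*4)*8))).
by rewrite !lie_jacobi !addr0.
Qed.

HB.instance Definition _ :=
  Lmodule_isLie.Build K dual_lie dual_bilinear dual_alternating dual_jacobi.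

(** A morphism [f] to the dual numbers whose first component is the identity has
    a derivation as its second component; [e |-> iota e + eps (g e)] extends to
    such an [f] by freeness. *)
Lemma free_lie_derivation (E : Type) (iota : E -> L) (g : E -> L) :
  is_free_lie iota ->
  exists d : {linear L -> L}, (forall e, d (iota e) = g e) /\
    (forall x y, d [lie x, y] = [lie d x, y] + [lie x, d y]).
Proof.
move=> freeL.
have [[f [f_lie f_gen]] _] := freeL dual_lie (fun e => (iota e, g e)).
have fst_lin : linear (fun x => (f x).1) by move=> a x y; rewrite linearP.
have snd_lin : linear (fun x => (f x).2) by move=> a x y; rewrite linearP.
pose f1 : {linear L -> L} :=
  HB.pack (fun x => (f x).1) (GRing.isLinear.Build _ _ _ _ _ fst_lin).
pose f2 : {linear L -> L} :=
  HB.pack (fun x => (f x).2) (GRing.isLinear.Build _ _ _ _ _ snd_lin).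
(* Both sides are Lie endomorphisms of L fixing the generators. *)
have fst_f x : (f x).1 = x.
  have [_ unique_id] := freeL L iota.
  apply: (unique_id f1 idfun) => //= [u v|e] /=; first by rewrite f_lie.
  by have /= -> := f_gen e.
exists f2; split=> [e|x y] /=; first by have /= -> := f_gen e.
by rewrite f_lie /= !fst_f addrC.
Qed.

End DualNumbers.

(** * The homogeneous elements span *)

Section HomogeneousSpan.
Variables (K : comNzRingType) (E : Type) (deg : E -> nat).
Variables (L : lieAlgType K) (iota : E -> L).

Local Notation homog := (homogeneous deg iota).

(** Only positive degrees are admitted, so that facts about the span can be
    proved by dividing by the degree. Being inductive, the span provides the
    principle by which linear properties are reduced to homogeneous elements. *)
Inductive homogeneous_span : L -> Prop :=
| span_homogeneous n x : (0 < n)%N -> homog n x -> homogeneous_span x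
| span_linear a x y : homogeneous_span x -> homogeneous_span y ->
    homogeneous_span (a *: x + y).

Lemma homogeneous_span_lie x y :
  homogeneous_span x -> homogeneous_span y -> homogeneous_span [lie x, y].
Proof.
elim=> [m {}x m_gt0 xm|a {}x1 x2 _ IH1 _ IH2] y_span.
  elim: y_span => [n {}y n_gt0 yn|a y1 y2 _ IH1 _ IH2].
    by apply: (@span_homogeneous (m + n)); [rewrite addn_gt0 m_gt0|constructor].
  by rewrite lieDr lieZr; apply: span_linear.
by rewrite lieDl lieZl; apply: span_linear; [apply: IH1|apply: IH2].
Qed.

Lemma free_lie_homogeneous_span :
  (forall e, (0 < deg e)%N) -> is_free_lie iota -> forall x, homogeneous_span x.
Proof.
move=> deg_gt0 freeL x.
have spanE y :
    reflect (homogeneous_span y) (y \in [set y | homogeneous_span y]).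
  by apply: (iffP idP); rewrite in_setE.
apply/spanE; apply: free_lie_gen freeL _ _.
- split=> [|a u v /spanE us /spanE vs]; apply/spanE; last exact: span_linear.
  by apply: (@span_homogeneous 1) => //; constructor.
- by move=> u v /spanE us /spanE vs; apply/spanE/homogeneous_span_lie.
- by move=> e; apply/spanE/(@span_homogeneous (deg e)) => //; constructor.
Qed.

(** Degrees are additive under the bracket, and by the Leibniz rule so are the
    eigenvalues of a derivation. *)
Lemma homogeneous_degree (d : {linear L -> L}) :
  (forall e, d (iota e) = (deg e)%:R *: iota e) ->
  (forall x y, d [lie x, y] = [lie d x, y] + [lie x, d y]) ->
  forall n x, homog n x -> d x = n%:R *: x.
Proof.
move=> d_gen d_lie n x; elim=> {n x} [//|m n x y _ dx _ dy|n|n a x y _ dx _ dy].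
- by rewrite d_lie dx dy lieZl lieZr -scalerDl natrD.
- by rewrite linear0 scaler0.
- by rewrite linearP dx dy scalerDr !scalerA mulrC.
Qed.

End HomogeneousSpan.

(** * Products of shifts of an endomorphism *)

Section ShiftProduct.
Variables (K : fieldType) (V : lmodType K) (d : {linear V -> V}).
Implicit Types (s t : seq K) (x y : V).

(** The value at [x] of the polynomial [\prod_(c <- s) ('X - c)] in [d]. A
    finite sum of eigenvectors is killed by such a product, which makes it
    possible to do without the direct sum decomposition into eigenspaces. *)
Definition shift_prod s x := foldr (fun c y => d y - c *: y) x s.

Lemma shift_prod_linear s : linear (shift_prod s).
Proof.
move=> a x y; elim: s => //= c s ->; rewrite linearP scalerDr opprD addrACA.
by rewrite scalerBr !scalerA mulrC.
Qed.

HB.instance Definition _ s :=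
  GRing.isLinear.Build _ _ _ _ (shift_prod s) (shift_prod_linear s).

Lemma shift_prod_shift s c x :
  shift_prod s (d x - c *: x) = d (shift_prod s x) - c *: shift_prod s x.
Proof.
elim: s => //= b s ->; rewrite !linearB !linearZ /= !scalerA.
by rewrite (mulrC b) -!addrA; congr (_ + _); rewrite addrCA.
Qed.

Lemma shift_prodC s t x :
  shift_prod s (shift_prod t x) = shift_prod t (shift_prod s x).
Proof. by elim: t => //= c t IHt; rewrite shift_prod_shift IHt. Qed.

(** On the kernel of [d] the factor [d - c] is multiplication by [- c]. *)
Lemma shift_prod_ker s x : 0 \notin s -> d x = 0 ->
  exists2 k, k != 0 & shift_prod s x = k *: x.
Proof.
move=> + dx0; elim: s => [_|c s IHs] /=.
  by exists 1; rewrite ?oner_eq0 ?scale1r.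
rewrite inE negb_or eq_sym => /andP[c_neq0 /IHs[k k_neq0 ->]].
exists (- (c * k)); first by rewrite oppr_eq0 mulf_neq0.
by rewrite linearZ /= dx0 scaler0 sub0r scalerA scaleNr.
Qed.

End ShiftProduct.

(** * Inverting the Euler derivation *)

Section EulerDerivation.
Variables (K : fieldType) (charK0 : [pchar K] =i pred0).
Variables (E : Type) (deg : E -> nat) (deg_gt0 : forall e, (0 < deg e)%N).
Variables (L : lieAlgType K) (iota : E -> L) (freeL : is_free_lie iota).
Variable d : {linear L -> L}.
Hypothesis d_homog : forall n x, homogeneous deg iota n x -> d x = n%:R *: x.

Lemma degree_neq0 n : (0 < n)%N -> n%:R != 0 :> K.
Proof. by move/pcharf0P: charK0 => ->; rewrite -lt0n. Qed.

(** The shifts that kill [x] and those that kill [y] commute, so together they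
    kill every linear combination of [x] and [y]. Hence every element is killed
    by shifts by nonzero scalars, which leave no room for a kernel. *)
Lemma euler_injective : injective d.
Proof.
suff ker_d x : d x = 0 -> x = 0.
  by move=> x y eq_d; apply/subr0_eq/ker_d; rewrite linearB /= eq_d subrr.
move=> dx0.
have [s s_neq0 sx0] : exists2 s, 0 \notin s & shift_prod d s x = 0.
  elim: (free_lie_homogeneous_span deg_gt0 freeL x) => {dx0 x}.
    move=> n x n_gt0 /d_homog dx; exists [:: n%:R].
      by rewrite inE eq_sym degree_neq0.
    by rewrite /= dx subrr.
  move=> a x y _ [s s_neq0 sx0] _ [t t_neq0 ty0]; exists (s ++ t).
    by rewrite mem_cat negb_or s_neq0.
  rewrite /shift_prod foldr_cat -/(shift_prod d t _) -/(shift_prod d s _).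
  rewrite linearP /= ty0 addr0 linearZ /=.
  by rewrite shift_prodC sx0 linear0 scaler0.
case: (shift_prod_ker s_neq0 dx0) => k k_neq0; rewrite sx0 => /esym/eqP.
by rewrite scaler_eq0 (negPf k_neq0) => /eqP.
Qed.

Lemma euler_surjective y : exists x, d x = y.
Proof.
elim: (free_lie_homogeneous_span deg_gt0 freeL y) => {y}.
  move=> n x n_gt0 /d_homog dx; exists (n%:R^-1 *: x).
  by rewrite linearZ /= dx scalerA mulVf ?scale1r ?degree_neq0.
by move=> a _ _ _ [x <-] _ [y <-]; exists (a *: x + y); rewrite linearP.
Qed.

Lemma euler_inverse : exists T : {linear L -> L}, cancel d T /\ cancel T d.
Proof.
have [T TK] := choice euler_surjective.
have dK : cancel d T by move=> x; apply: euler_injective; rewrite TK.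
have T_lin : linear T.
  by move=> a x y; apply: euler_injective; rewrite linearP !TK.
pose T' : {linear L -> L} := HB.pack T (GRing.isLinear.Build _ _ _ _ _ T_lin).
by exists T'.
Qed.

(** This identifies [(x, y) |-> [lie T x, y]] as the scaled bracket. *)
Lemma euler_inverse_homogeneous (T : {linear L -> L}) n x : cancel d T ->
  homogeneous deg iota n x -> T x = n%:R^-1 *: x.
Proof.
move=> dK xn; apply: (canLR dK); rewrite linearZ /= (d_homog xn) scalerA.
(* In degree 0 the inverse of n%:R is 0 by convention; this is harmless, as
   the component of degree 0 is killed by d and hence trivial. *)
case: (posnP n) xn => [-> x0|n_gt0 _]; last first.
  by rewrite mulVf ?scale1r ?degree_neq0.
by apply: (can_inj dK); rewrite (d_homog x0) scale0r mulr0 scale0r linear0.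
Qed.

End EulerDerivation.

(** * Pre-Lie products from invertible derivations *)

Section Derivation.
Variables (K : comNzRingType) (L : lieAlgType K) (d T : {linear L -> L}).
Hypotheses (dK : cancel d T) (TK : cancel T d).
Hypothesis (d_lie : forall x y, d [lie x, y] = [lie d x, y] + [lie x, d y]).

(** The difference [T [lie u, d v] - T [lie v, d u]] is [T (d [lie u, v])], that
    is, [[lie u, v]]: this turns the antisymmetrised associator into the Jacobi
    identity for [u], [v], [z], where [u := T x] and [v := T y]. *)
Lemma derivation_pre_lie : left_pre_lie (fun x y => [lie T x, y]).
Proof.
move=> x y z.
have : [lie T x, T y] = T [lie T x, y] - T [lie T y, x].
  by rewrite -[LHS]dK d_lie !TK (lieC x) linearD linearN addrC.
move/(congr1 (fun u => [lie u, z])); rewrite lie_jacobi_ad lieDl lieNl => eqz.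
rewrite -[[lie T [lie T x, y], z]](subrK [lie T [lie T y, x], z]) -eqz.
by rewrite addrAC [X in X + _]addrAC subrr sub0r addrC.
Qed.

End Derivation.

(** * The pre-Lie product on a free Lie algebra *)

Theorem proposition2 (K : fieldType) (charK0 : [pchar K] =i pred0)
    (E : Type) (E_nonempty : inhabited E)
    (deg : E -> nat) (deg_gt0 : forall e, (0 < deg e)%N)
    (E_finite : forall i, finite_set [set e | deg e = i])
    (L : lieAlgType K) (iota : E -> L) (freeL : is_free_lie iota) :
  (exists! rhd : L -> L -> L, is_scaled_bracket deg iota rhd) /\
  (forall rhd : L -> L -> L, is_scaled_bracket deg iota rhd ->
     bilinear_op rhd /\ left_pre_lie rhd).
Proof.
have [d [d_gen d_lie]] :=
  free_lie_derivation (fun e => (deg e)%:R *: iota e) freeL.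
have d_homog := homogeneous_degree d_gen d_lie.
have [T [dK TK]] := euler_inverse charK0 deg_gt0 freeL d_homog.
have rhd_lin : bilinear_op (fun x y => [lie T x, y]).
  split=> [y|x] a u v; first by rewrite linearP lieDl lieZl.
  by rewrite lieDr lieZr.
have rhd_scaled : is_scaled_bracket deg iota (fun x y => [lie T x, y]).
  split=> [|n x y xn]; first exact: rhd_lin.1.
  by rewrite (euler_inverse_homogeneous charK0 d_homog dK xn) lieZl.
(* Both sides are linear in x, and in each positive degree both conditions fix
   the value. *)
have rhd_unique rhd : is_scaled_bracket deg iota rhd ->
    (fun x y => [lie T x, y]) = rhd.
  move=> [rhd_linl rhd_homog]; apply/funext => x; apply/funext => y.
  elim: (free_lie_homogeneous_span deg_gt0 freeL x) => {x}.
    move=> n x _ xn.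
    exact: etrans (rhd_scaled.2 _ _ _ xn) (esym (rhd_homog _ _ _ xn)).
  move=> a u v _ rhd_u _ rhd_v.
  by rewrite linearP lieDl lieZl rhd_u rhd_v (rhd_linl y).
split; first by exists (fun x y => [lie T x, y]).
move=> rhd /rhd_unique <-; split=> //; exact: derivation_pre_lie dK TK d_lie.
Qed.
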